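(* Let $W$ be a line graphon, i.e. a step-graphon with a partition $\sigma=(\sigma_0,\ldots,\sigma_q)$ for which the associated skeleton graph $S$ is a path graph on $q$ nodes together with exactly one self-loop, attached to one of the ending nodes of the path. Let $x^*=(x^*_1,\ldots,x^*_q)$, $x^*_i=\sigma_i-\sigma_{i-1}$, be the concentration vector of $W$ for $\sigma$, and let $\mathcal{X}(S)\subset\mathbb{R}^q$ be the edge polytope of $S$. If $x^*$ belongs to the relative interior of $\mathcal{X}(S)$, then $W$ has the $H$-property, i.e., for $G_n\sim W$, $$\lim_{n\to\infty}\mathbb{P}(\vec G_n \text{ has a Hamiltonian decomposition})=1.$$
   Context: A graphon is a symmetric, measurable function $W:[0,1]^2\to[0,1]$. Sampling: $G_n=(V,E)\sim W$ denotes the random undirected graph on $n$ nodes $v_1,\ldots,v_n$ obtained as follows: sample $y_1,\ldots,y_n$ independently and uniformly from $[0,1]$ ($y_i$ is the coordinate of node $v_i$); then, for any two distinct nodes $v_i,v_j$, place an edge $(v_i,v_j)$ with probability $W(y_i,y_j)$, independently over pairs given the coordinates. There are no self-loops in $G_n$. Directed version and Hamiltonian decomposition: for an undirected graph $G=(V,E)$, its directed version $\vec G=(V,\vec E)$ has the same node set, and each undirected edge $(v_i,v_j)\in E$ is replaced by the two directed edges $v_iv_j$ and $v_jv_i$. A Hamiltonian decomposition of $\vec G$ is a subgraph $\vec H=(V,\vec E')$ with the same node set as $\vec G$ which is a disjoint union of directed cycles (directed cycles of length two are allowed). $H$-property: $W$ has the $H$-property if, for $G_n\sim W$, $\lim_{n\to\infty}\mathbb{P}(\vec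 G_n\text{ has a Hamiltonian decomposition})=1$. Step-graphon: $W$ is a step-graphon if there is an increasing sequence $0=\sigma_0<\sigma_1<\cdots<\sigma_q=1$ such that $W$ is constant over each rectangle $[\sigma_i,\sigma_{i+1})\times[\sigma_j,\sigma_{j+1})$, $0\le i,j\le q-1$. The sequence $\sigma=(\sigma_0,\ldots,\sigma_q)$ is called a partition for $W$. Skeleton graph: the skeleton graph $S=(U,F)$ of $W$ for $\sigma$ is the undirected graph (self-loops allowed) on $U=\{u_1,\ldots,u_q\}$ with an edge between $u_i$ and $u_j$ (a self-loop if $i=j$) if and only if $W$ is non-zero over $[\sigma_{i-1},\sigma_i)\times[\sigma_{j-1},\sigma_j)$. Edge polytope: let $e_1,\ldots,e_q$ be the standard basis of $\mathbb{R}^q$. To each edge of $S$ between distinct nodes $u_i,u_j$ associate the vector $\frac12(e_i+e_j)$, and to each self-loop on $u_i$ associate the vector $e_i$. The edge polytope $\mathcal{X}(S)$ is the convex hull of all these vectors. *)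

(* Defs.v *)
(* MathComp-Analysis development. *)
From HB Require Import structures.
From mathcomp Require Import all_boot all_order all_fingroup all_algebra.
From mathcomp Require Import all_classical all_reals all_analysis.

Set Implicit Arguments.
Unset Strict Implicit.
Unset Printing Implicit Defensive.

Import Order.TTheory GRing.Theory Num.Theory.
Import numFieldNormedType.Exports.

Local Open Scope classical_set_scope.
Local Open Scope ring_scope.

(* Only the values of [W] on the unit square are constrained or ever used. *)
Record graphon (R : realType) (W : R * R -> R) : Prop := Graphon {
  graphon_sym : forall x y : R, x \in `[0, 1] -> y \in `[0, 1] ->
    W (x, y) = W (y, x) ;
  graphon_measurable : measurable_fun ((`[0, 1] : set R) `*` (`[0, 1] : set R)) W ;
  graphon_range : forall x y : R, x \in `[0, 1] -> y \in `[0, 1] ->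
    0 <= W (x, y) <= 1 }.

(* A simple graph on the node set ['I_n] is given by its set of edges, each
   edge being a set of two distinct nodes. *)
Definition simple_graph n (g : {set {set 'I_n}}) : Prop :=
  forall e, e \in g -> #|e| = 2%N.

(* Conditional probability of drawing exactly the graph [g] when the nodes have
   coordinates [y]; each unordered pair of nodes is counted once, as i < j. *)
Definition graph_likelihood (R : realType) (W : R * R -> R) n
    (y : 'I_n -> R) (g : {set {set 'I_n}}) : R :=
  \prod_(p : 'I_n * 'I_n | (p.1 < p.2)%N)
    if [set p.1; p.2]%SET \in g then W (y p.1, y p.2)
    else 1 - W (y p.1, y p.2).

(* [G ~ W] on [n] nodes, for a random graph [G] with random coordinates [y].
   In [sample_conditional], the sets [[set w | B [tuple y i w | i < n]]] with
   [B] measurable are exactly the events of the sigma-algebra generated by the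
   coordinates, so that the clause says that [graph_likelihood W y g] is the
   conditional probability of [G = g] given the coordinates. *)
Record sampled_from (R : realType) (W : R * R -> R) (n : nat)
    (d : measure_display) (T : measurableType d) (P : probability T R)
    (y : 'I_n -> {RV P >-> R}) (G : T -> {set {set 'I_n}}) : Prop :=
  SampledFrom {
  sample_coord_range : forall i w, y i w \in `[0, 1] ;
  sample_uniform : forall i (B : set R), measurable B ->
    distribution P (y i) B = uniform_prob (@ltr01 R) B ;
  sample_independent : forall B : 'I_n -> set R,
    (forall i, measurable (B i)) ->
    P (\bigcap_i (y i @^-1` B i)) = (\prod_(i < n) P (y i @^-1` B i))%E ;
  sample_simple : forall w, simple_graph (G w) ;
  sample_measurable : forall g, measurable (G @^-1` [set g]) ;
  sample_conditional : forall (B : set (n.-tuple R)) (g : {set {set 'I_n}}),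
    measurable B -> simple_graph g ->
    let A := [set w | B [tuple y i w | i < n]] in
    P (A `&` G @^-1` [set g]) =
      (\int[P]_(w in A) (graph_likelihood W (fun i => y i w) g)%:E)%E }.

Arguments sampled_from {R} W n {d T} P y G.

Definition directed_version n (g : {set {set 'I_n}}) : {set 'I_n * 'I_n} :=
  [set a : 'I_n * 'I_n | [set a.1; a.2]%SET \in g]%SET.

(* The arcs of the directed cycles listed in [C]; a cycle is the sequence of its
   nodes, the last one being followed by the first one. *)
Definition cycles_arcs (V : finType) (C : seq (seq V)) : {set V * V} :=
  [set a : V * V | has (fun c => (a.1 \in c) && (a.2 == next c a.1)) C]%SET.

(* [H] is the arc set of a disjoint union of directed cycles, of length at least
   two, whose node set is the whole of [V]. *)
Definition disjoint_cycles (V : finType) (H : {set V * V}) : Prop :=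
  exists C : seq (seq V),
    [/\ all (fun c => 1 < size c)%N C, uniq (flatten C),
        forall v : V, v \in flatten C & H = cycles_arcs C].

Definition has_hamiltonian_decomposition (V : finType) (D : {set V * V}) :
    Prop :=
  exists2 H : {set V * V}, H \subset D & disjoint_cycles H.

(* The law of [G_n] is determined by [W], so the choice of the probability
   spaces carrying the samples is immaterial; all choices are covered. *)
Definition H_property (R : realType) (W : R * R -> R) : Prop :=
  forall (d : nat -> measure_display) (T : forall n, measurableType (d n))
    (P : forall n, probability (T n) R)
    (y : forall n, 'I_n -> {RV (P n) >-> R})
    (G : forall n, T n -> {set {set 'I_n}}),
  (forall n, sampled_from W n (P n) (y n) (G n)) ->
  P n [set w | has_hamiltonian_decomposition (directed_version (G n w))]
    @[n --> \oo] --> 1%E.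

(* With [q] blocks indexed by ['I_q], block [i] has end points [lo sigma i] and
   [hi sigma i]; it is the (i+1)-st block of the 1-based convention. *)
Definition lo (R : realType) q (sigma : 'I_q.+1 -> R) (i : 'I_q) : R :=
  sigma (widen_ord (leqnSn q) i).

Definition hi (R : realType) q (sigma : 'I_q.+1 -> R) (i : 'I_q) : R :=
  sigma (lift ord0 i).

Definition block (R : realType) q (sigma : 'I_q.+1 -> R) (i : 'I_q) : set R :=
  `[lo sigma i, hi sigma i[.

Record step_partition (R : realType) (W : R * R -> R) q
    (sigma : 'I_q.+1 -> R) : Prop := StepPartition {
  step_first : sigma ord0 = 0 ;
  step_last : sigma ord_max = 1 ;
  step_increasing : {homo sigma : i j / (i < j)%N >-> i < j} ;
  step_constant : forall i j, exists c, forall x y,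
    block sigma i x -> block sigma j y -> W (x, y) = c }.

(* The adjacency relation of the skeleton graph; [skeleton W sigma i i] means
   that there is a self-loop on [i]. *)
Definition skeleton (R : realType) (W : R * R -> R) q (sigma : 'I_q.+1 -> R)
    (i j : 'I_q) : Prop :=
  forall x y, block sigma i x -> block sigma j y -> W (x, y) != 0.

(* [s] lists the nodes in their order along the path. *)
Definition path_with_end_loop q (F : 'I_q -> 'I_q -> Prop) : Prop :=
  exists s : {perm 'I_q},
    (forall i j, i != j ->
       (F (s i) (s j) <-> i.+1 = j :> nat \/ j.+1 = i :> nat)) /\
    exists2 k : 'I_q, k = 0%N :> nat \/ k.+1 = q :> nat &
      forall i, F (s i) (s i) <-> i = k.

Definition line_graphon (R : realType) (W : R * R -> R) q
    (sigma : 'I_q.+1 -> R) : Prop :=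
  [/\ graphon W, step_partition W sigma &
      path_with_end_loop (skeleton W sigma)].

Definition concentration (R : realType) q (sigma : 'I_q.+1 -> R) : 'rV[R]_q :=
  \row_i (hi sigma i - lo sigma i).

Definition convex_hull (R : realType) (V : lmodType R) (A : set V) : set V :=
  [set x | exists m (a : 'I_m -> R) (v : 'I_m -> V),
    [/\ forall k, 0 <= a k, \sum_k a k = 1, forall k, A (v k) &
        x = \sum_k a k *: v k]].

Definition affine_hull (R : realType) (V : lmodType R) (A : set V) : set V :=
  [set x | exists m (a : 'I_m -> R) (v : 'I_m -> V),
    [/\ \sum_k a k = 1, forall k, A (v k) & x = \sum_k a k *: v k]].

(* The interior of [A] for the subspace topology of its affine hull. *)
Definition relative_interior (R : realType) (V : normedModType R) (A : set V) :
    set V :=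
  [set x | A x /\ within (affine_hull A) (nbhs x) A].

Definition edge_polytope (R : realType) q (F : 'I_q -> 'I_q -> Prop) :
    set 'rV[R]_q :=
  convex_hull
    [set v | exists i j, F i j /\
       v = if i == j then 'e_i else 2^-1 *: ('e_i + 'e_j)].

(* Main.v *)
Require Import Defs.
From mathcomp Require Import all_boot.
From mathcomp Require Import zify.

(** Let the blocks be enumerated along the path so that the self-loop is at the
    last one. Cover the nodes of a sampled graph by cycles as follows: decide
    how many nodes of each block have their successor in each adjacent block
    (or, for the last block, in the block itself), with equally many in both
    directions along every edge, and look for a bijection along the edges of the
    graph between each of the resulting classes of nodes and the opposite one.
    Together these bijections form a permutation that moves every node to a
    neighbour, and the orbits of such a permutation are a Hamiltonian
    decomposition ([hamiltonian_decomposition_of_injection]).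

    The sizes of the classes are forced by the block sizes: along a path, the
    load of each edge is what the previous edge leaves over ([path_weight]). For
    the concentration vector, the loads are a positive multiple of the
    barycentric coordinates of the edge polytope, which is a simplex, so that
    they are all positive exactly at the points of the relative interior
    ([path_weight_gt0]). By Chebyshev's inequality ([chebyshev_counts]) the
    proportions of the blocks converge in probability to the concentration
    vector, hence the integer loads of the sampled graph grow linearly in the
    number [n] of nodes ([path_classes]).

    Given the blocks of the nodes, the edges between a class and the opposite
    one are independent and each is present with a probability bounded below.
    By Hall's theorem ([hall]), if there is no bijection then some set [X] of
    nodes has no edge to a large part, of linear size, of the opposite class
    ([injection_of_no_sparse_pair]). This costs at least a factor [r ^+ K] for each
    element of [X], where [r < 1] and [K] is linear in [n], and a union bound
    over all the sets gives a failure probability that tends to zero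
    ([sum_likelihood_sparse], [conditional_failure_bound]). As [W] is constant
    on the blocks, conditioning on the blocks turns everything into finite sums
    ([sample_success_bound]). *)

Set Implicit Arguments.
Unset Strict Implicit.
Unset Printing Implicit Defensive.

(** * Hall's theorem *)

Section Hall.
Variables T U : finType.
Implicit Types (R : T -> pred U) (A X Y : {set T}).

Definition nbrs R X : {set U} := [set u | [exists t in X, R t u]].

Lemma nbrsP R X u : reflect (exists2 t, t \in X & R t u) (u \in nbrs R X).
Proof. by rewrite inE; exact: exists_inP. Qed.

Lemma nbrsS R X Y : X \subset Y -> nbrs R X \subset nbrs R Y.
Proof.
move=> /subsetP XY; apply/subsetP => u /nbrsP[t tX Rtu].
by apply/nbrsP; exists t => //; apply: XY.
Qed.

(** Induction on [A]. If some proper nonempty part [X] of [A] has exactly [#|X|]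
    neighbours, match [X] inside them and the rest of [A] outside them; if
    every such part has a neighbour to spare, an arbitrary first choice keeps
    the condition true. The value [u0] is only a default outside [A]. *)
Lemma hall_on (u0 : U) R A :
    (forall X, X \subset A -> #|X| <= #|nbrs R X|) ->
  exists2 f : T -> U, {in A &, injective f} & {in A, forall t, R t (f t)}.
Proof.
have [n] := ubnP #|A|; elim: n A R => // n IHn A R ltAn hallA.
have [->|[a aA]] := set_0Vmem A.
  by exists (fun=> u0) => [x y|x]; rewrite inE.
have [/existsP[X /and4P[sXA X0 XA /eqP tight]]|] := boolP
  [exists X : {set T}, [&& X \subset A, X != set0, X != A & #|nbrs R X| == #|X|]].
  have ltXA : #|X| < #|A| by rewrite proper_card // properEneq XA.
  have [//||f fI fR] := IHn X R; first by apply: leq_trans ltXA _.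
    by move=> Y sYX; apply: hallA; apply: subset_trans sXA.
  pose R' t u := R t u && (u \notin nbrs R X).
  have [||f' f'I f'R] := IHn (A :\: X) R'.
  - rewrite ltnS in ltAn; apply: leq_trans ltAn; apply: proper_card.
    rewrite properEneq subsetDl andbT; apply: contra_neqN X0 => /eqP E.
    apply/setP => x; rewrite inE; apply/negP => xX.
    by have := subsetP sXA x xX; rewrite -E inE xX.
  - move=> Y sYAX; have sub : nbrs R (X :|: Y) :\: nbrs R X \subset nbrs R' Y.
      apply/subsetP => u; rewrite inE => /andP[uX /nbrsP[t]].
      rewrite inE => /orP[tX Rtu|tY Rtu].
        by case/negP: uX; apply/nbrsP; exists t.
      by apply/nbrsP; exists t; rewrite // /R' Rtu.
    have dXY : X :&: Y = set0.
      apply/setP => x; rewrite !inE; apply/negP => /andP[xX xY].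
      by have := subsetP sYAX x xY; rewrite inE xX.
    have := hallA (X :|: Y); rewrite subUset sXA (subset_trans sYAX) ?subsetDl//.
    move=> /(_ isT); rewrite cardsU dXY cards0 subn0.
    have := subset_leq_card sub; rewrite cardsD.
    rewrite (setIidPr (nbrsS R (subsetUl X Y))) tight; lia.
  have fX x : x \in X -> f x \in nbrs R X.
    by move=> xX; apply/nbrsP; exists x => //; apply: fR.
  have f'X x : x \in A -> x \notin X -> R x (f' x) /\ f' x \notin nbrs R X.
    by move=> xA xX; apply/andP; apply: f'R; rewrite inE xX.
  exists (fun t => if t \in X then f t else f' t).
    move=> x y xA yA; case: ifPn => xX; case: ifPn => yX.
    - exact: fI.
    - by move=> E; case: (f'X _ yA yX) => _; rewrite -E fX.
    - by move=> E; case: (f'X _ xA xX) => _; rewrite E fX.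
    - by apply: f'I; rewrite inE ?xX ?yX.
  by move=> x xA; case: ifPn => xX; [apply: fR | case: (f'X _ xA xX)].
rewrite negb_exists => /forallP slack.
have /card_gt0P[b /nbrsP[t]] : 0 < #|nbrs R [set a]|.
  by rewrite -(cards1 a) hallA // sub1set.
rewrite inE => /eqP-> {t} Rab.
pose R' t u := R t u && (u != b).
have ltA : #|A :\ a| < n by rewrite (cardsD1 a) aA in ltAn.
have [|f fI fR] := IHn (A :\ a) R' ltA.
  move=> X sXA; have [->|X0] := eqVneq X set0; first by rewrite cards0.
  have sub : nbrs R X :\ b \subset nbrs R' X.
    apply/subsetP => u; rewrite in_setD1 => /andP[ub /nbrsP[t tX Rtu]].
    by apply/nbrsP; exists t; rewrite // /R' Rtu.
  have sX : X \subset A by apply: subset_trans sXA _; exact: subsetDl.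
  have := slack X; rewrite sX X0 /=.
  have -> /= : X != A.
    by apply: contraTneq sXA => ->; apply/subsetPn; exists a; rewrite // !inE eqxx.
  have := hallA X sX; have := subset_leq_card sub.
  by rewrite (cardsD1 b (nbrs R X)); case: (b \in _) => /=; lia.
have fRA x : x \in A -> x != a -> R x (f x) /\ f x != b.
  by move=> xA xa; apply/andP; apply: fR; rewrite !inE xa.
exists (fun t => if t == a then b else f t).
  move=> x y xA yA; case: eqVneq => [->|xa]; case: eqVneq => [->|ya] //.
  - by move=> E; case: (fRA _ yA ya) => _; rewrite -E eqxx.
  - by move=> E; case: (fRA _ xA xa) => _; rewrite E eqxx.
  - by apply: fI; rewrite !inE ?xa ?ya.
by move=> x xA; case: eqVneq => [->|xa] //; case: (fRA _ xA xa).
Qed.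

End Hall.

Theorem hall (T U : finType) (R : T -> pred U) :
    (forall X : {set T}, #|X| <= #|nbrs R X|) ->
  exists2 f : T -> U, injective f & forall t, R t (f t).
Proof.
move=> hallR; have [t0|noT] := pickP T; last first.
  have f0 (t : T) : U by have := noT t.
  by exists f0 => t; have := noT t.
have /card_gt0P[u0 _] : 0 < #|nbrs R [set t0]| by rewrite -(cards1 t0).
have [|f fI fR] := @hall_on T U u0 R [set: T]; first by move=> X _; exact: hallR.
exists f => [x y fxy|t]; last exact: fR.
by apply: fI.
Qed.

(** * Decompositions from injections along edges *)

(** A self-injection of a finite set is a permutation, and its orbits are the
    required cycles: none is a fixed point because edges have two nodes, and
    an orbit of length two uses one edge in both directions. *)
Lemma hamiltonian_decomposition_of_injection n (g : {set {set 'I_n}})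
    (f : 'I_n -> 'I_n) :
    simple_graph g -> injective f -> (forall v, [set v; f v] \in g) ->
  has_hamiltonian_decomposition (directed_version g).
Proof.
move=> sg fI fg.
have fix0 v : f v != v.
  by have := sg _ (fg v); rewrite cards2 eq_sym; case: eqVneq.
pose C := [seq orbit f x | x <- enum (froots f)].
have inC c : c \in C -> exists x, c = orbit f x.
  by case/mapP => x _ ->; exists x.
exists (cycles_arcs C).
  apply/subsetP => a; rewrite !inE => /hasP[c /inC[x ->]] /andP[ax /eqP Ea].
  have := next_cycle (cycle_orbit fI x) ax; rewrite -Ea => /eqP <-.
  exact: fg.
exists C; split => //.
- apply/allP => c /inC[x ->]; rewrite size_orbit.
  have := fix0 x; case E: (order f x) => [|[|//]].
    by have := order_gt0 f x; rewrite E.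
  by have := iter_order fI x; rewrite E /= => ->; rewrite eqxx.
- have -> : flatten C = [seq y | x <- enum (froots f), y <- orbit f x].
    by congr flatten; apply: eq_map => x; rewrite map_id.
  apply: allpairs_uniq_dep => [|x _|]; first exact: enum_uniq.
    exact: orbit_uniq.
  move=> _ _ /allpairsPdep[x [y [xr yx ->]]] /allpairsPdep[x' [y' [x'r y'x' ->]]].
  rewrite /= => E; subst y'.
  suff -> : x = x' by [].
  rewrite !mem_enum in xr x'r; rewrite -!fconnect_orbit in yx y'x'.
  have sym := fconnect_sym fI.
  rewrite -(eqP xr) -(eqP x'r); apply/eqP; rewrite root_connect //.
  by apply: connect_trans yx _; rewrite sym.
- move=> v; apply/flatten_mapP; exists (froot f v).
    by rewrite mem_enum; apply: roots_root; exact: fconnect_sym.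
  by rewrite -fconnect_orbit fconnect_sym // connect_root.
Qed.

Lemma card_fibres (T K : finType) (h : T -> K) (A : {set T}) :
  #|A| = \sum_k #|[set a in A | h a == k]|.
Proof.
rewrite -sum1_card (partition_big h xpredT) //=.
by apply: eq_bigr => k _; rewrite sum1dep_card.
Qed.

Section ArcClasses.
Variables (n q : nat) (b c : 'I_n -> 'I_q) (g : {set {set 'I_n}}).

(** Here [b v] is the block of the node [v], and [c v] is the block in which the
    successor of [v] is to be found. A node of [arc_class i j] is sent to a node
    of [arc_class j i], so that a bijection between these two classes is wanted
    for all [i] and [j]. *)
Definition arc_class i j := [set v | (b v == i) && (c v == j)].

(** The obstruction to be excluded: more nodes in [X] than in [Y], although [Y]
    contains all the neighbours of [X] in the opposite class. The bound
    [2 * #|Y|] leaves at least half of that class without any edge to [X],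
    which is what makes the event very unlikely in a random graph. *)
Definition sparse_pair i j (X Y : {set 'I_n}) :=
  [&& X \subset arc_class i j, Y \subset arc_class j i, #|Y| < #|X|,
      2 * #|Y| <= #|arc_class i j| &
      [forall x in X, forall z in arc_class j i :\: Y, [set x; z] \notin g]].

(** If Hall's condition fails for the edges from each class to the opposite
    one, it fails inside some class: [X] there has fewer than [#|X|] neighbours
    [Y]. When [Y] is more than half of the opposite class, its complement and
    the complement of [X] form an obstruction in the other direction, with a
    small second component. *)
Lemma injection_of_no_sparse_pair :
    (forall i j, #|arc_class i j| = #|arc_class j i|) ->
    (forall i j X Y, ~~ sparse_pair i j X Y) ->
  exists2 f : 'I_n -> 'I_n, injective f & forall v, [set v; f v] \in g.
Proof.
move=> symN noSparse.
pose R v w := [&& [set v; w] \in g, b v == c w & c v == b w].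
suff [f fI fR] : exists2 f : 'I_n -> 'I_n, injective f & forall v, R v (f v).
  by exists f => // v; case/and3P: (fR v).
apply: hall => X; rewrite leqNgt; apply/negP => ltX.
pose Xp (p : 'I_q * 'I_q) := X :&: arc_class p.1 p.2.
pose Yp (p : 'I_q * 'I_q) := nbrs R X :&: arc_class p.2 p.1.
have [p ltp] : exists p, #|Yp p| < #|Xp p|.
  apply/existsP; apply: contraTT ltX; rewrite negb_exists => /forallP le.
  rewrite -leqNgt (card_fibres (fun v => (b v, c v)) X).
  rewrite (card_fibres (fun v => (c v, b v)) (nbrs R X)).
  apply: leq_sum => p _; have := le p; rewrite -leqNgt /Xp /Yp.
  congr (_ <= _); apply: eq_card => v; rewrite !inE -pair_eqE //=.
  by rewrite [(b v == _) && _]andbC.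
case: p ltp => i j ltp; set X' := Xp _ in ltp; set Y' := Yp _ in ltp.
have sX : X' \subset arc_class i j by exact: subsetIr.
have sY : Y' \subset arc_class j i by exact: subsetIr.
have noedge x z : x \in X' -> z \in arc_class j i :\: Y' -> [set x; z] \notin g.
  rewrite in_setI => /andP[xX xS]; rewrite in_setD => /andP[zY zS].
  apply: contra zY => xz; rewrite inE zS andbT; apply/nbrsP; exists x => //.
  rewrite /R xz; move: xS zS; rewrite !inE => /andP[/eqP-> /eqP->].
  by move=> /andP[/eqP-> /eqP->]; rewrite !eqxx.
have [small|big] := leqP (2 * #|Y'|) #|arc_class i j|.
  have := noSparse i j X' Y'; rewrite /sparse_pair sX sY ltp small /=.
  by case/negP; apply/forall_inP => x xX; apply/forall_inP => z; exact: noedge.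
(* Otherwise the roles of the two sides are exchanged: the nodes outside [Y']
   only see the nodes outside [X']. *)
have := noSparse j i (arc_class j i :\: Y') (arc_class i j :\: X').
have := cardsID X' (arc_class i j); have := cardsID Y' (arc_class j i).
rewrite (setIidPr sX) (setIidPr sY) => cY cX; have sij := symN i j.
have arith (N N' x y x' y' : nat) : y + y' = N' -> x + x' = N -> N = N' ->
    y < x -> N < 2 * y -> x' < y' /\ 2 * x' <= N' by lia.
have [less half] := arith _ _ _ _ _ _ cY cX sij ltp big.
rewrite /sparse_pair !subsetDl /=; case/negP; apply/and3P; split.
- exact: less.
- exact: half.
apply/forall_inP => z zY; apply/forall_inP => x.
rewrite !in_setD negb_and negbK => /andP[/orP[xX _|/negP//]].
by rewrite setUC; exact: noedge.
Qed.

End ArcClasses.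

(** * Integer flows on a path with a loop at its end *)

Lemma subset_of_card (T : finType) (A : {set T}) k : k <= #|A| ->
  exists2 B : {set T}, B \subset A & #|B| = k.
Proof.
rewrite -bin_gt0 -(cards_draws A k) => /card_gt0P[B].
by rewrite inE => /andP[sBA /eqP]; exists B.
Qed.

Section Flow.
Variables (n q : nat) (b : 'I_n -> 'I_q.+1).

(** The path [0 - 1 - ... - q] with a loop at its last node. *)
Definition path_adj (i j : 'I_q.+1) :=
  [|| i.+1 == j, j.+1 == i | (i == j) && (i.+1 == q.+1)].

(** The edge between [i] and [i.+1] has index [i.+1] and the loop has index
    [q.+1], so the indices of the edges are [1, ..., q.+1]. *)
Definition edge_index (i j : 'I_q.+1) := if i == j then q.+1 else maxn i j.

(** [F k] is the number of nodes that use the edge of index [k] in each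
    direction. Block [i] is met by the edges [i] and [i.+1] only, and a choice
    of [F i] of its nodes, to be sent backwards, determines [c]. *)
Lemma path_flow (F : nat -> nat) :
    F 0 = 0 ->
    (forall i : 'I_q.+1, F i + F i.+1 = #|[set v | b v == i]|) ->
  exists c : 'I_n -> 'I_q.+1, forall i j,
    #|arc_class b c i j| = if path_adj i j then F (edge_index i j) else 0.
Proof.
move=> F0 Fcnt.
have [A AP] : exists A : 'I_q.+1 -> {set 'I_n}, forall i,
    A i \subset [set v | b v == i] /\ #|A i| = F i.
  apply: (@fin_all_exists _ (fun=> {set 'I_n})
            (fun i B => B \subset [set v | b v == i] /\ #|B| = F i)) => i.
  have [|B sB cB] := @subset_of_card _ [set v | b v == i] (F i).
    by rewrite -Fcnt leq_addr.
  by exists B.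
have A0 : A ord0 = set0 by apply/eqP; rewrite -cards_eq0 (AP _).2 F0.
have cA i : #|[set v | b v == i] :\: A i| = F i.+1.
  have [sA cA] := AP i; have := cardsID (A i) [set v | b v == i].
  by rewrite (setIidPr sA) cA -Fcnt => /addnI.
pose c v : 'I_q.+1 :=
  if v \in A (b v) then inord (b v).-1 else inord (minn (b v).+1 q).
have cE v : c v = (if v \in A (b v) then (b v).-1 else minn (b v).+1 q) :> nat.
  by rewrite /c; case: ifP => _; rewrite inordK //; have := ltn_ord (b v); lia.
exists c => i j.
have bpos v : v \in A (b v) -> 0 < b v.
  rewrite lt0n; apply: contraTN => /eqP E.
  by have -> : b v = ord0 by [apply: val_inj]; rewrite A0 inE.
have inA v : v \in A i -> b v = i.
  by have [/subsetP s _] := AP i; move/s; rewrite inE => /eqP.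
have lti := ltn_ord i; have ltj := ltn_ord j.
rewrite /path_adj /edge_index.
have [up|nup] := boolP ((i.+1 == j) || ((i == j) && (i.+1 == q.+1))).
  rewrite orbCA up orbT.
  have -> : (if i == j then q.+1 else maxn i j) = i.+1.
    move: up; rewrite -val_eqE /=; case: ifP; lia.
  rewrite -cA; apply: eq_card => v; rewrite !inE.
  have [bv|] := eqVneq (b v) i; last by rewrite andbF.
  rewrite andbT /=; have := cE v; have := bpos v; rewrite bv => pos cv.
  move: up; rewrite -!val_eqE /= cv; case: (v \in A i) pos => /= [/(_ isT)|_]; lia.
rewrite orbCA (negPf nup) orbF; case: ifPn => [down|ndown].
  have -> : (if i == j then q.+1 else maxn i j) = i.
    move: nup down; rewrite -val_eqE /=; case: ifP; lia.
  rewrite -(AP i).2; apply: eq_card => v; rewrite !inE.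
  have [bv|nbv] := eqVneq (b v) i; last first.
    by apply/esym/negP => /inA E; rewrite E eqxx in nbv.
  rewrite /=; have := cE v; have := bpos v; rewrite bv => pos cv.
  move: nup; rewrite -!val_eqE /= cv; case: (v \in A i) pos => /= [/(_ isT)|_]; lia.
apply: eq_card0 => v; rewrite !inE; apply/negP => /andP[/eqP bv /eqP cvj].
have := cE v; have := bpos v; rewrite cvj bv => pos cv.
by move: nup ndown; rewrite -!val_eqE /=; case: (v \in A i) pos cv => /= [/(_ isT)|_]; lia.
Qed.

End Flow.

From mathcomp Require Import all_order all_algebra.
From mathcomp Require Import boolp reals.
From mathcomp Require Import lra ring.

Import Order.TTheory GRing.Theory Num.Theory.
Local Open Scope ring_scope.

(** * Random graphs with given coordinates *)

Lemma sum_union_bound (R : numDomainType) (I J : finType) (P : pred I)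
    (E : J -> pred I) (f : I -> R) :
    (forall i, P i -> 0 <= f i) ->
  \sum_(i | P i && [exists j, E j i]) f i <=
  \sum_j \sum_(i | P i && E j i) f i.
Proof.
move=> f0; rewrite (exchange_big_dep P) /=; last by move=> j i _ /andP[].
rewrite [leLHS](eq_bigl (fun i => P i && [exists j, E j i])) //.
rewrite big_mkcondr /=; apply: ler_sum => i Pi.
case: ifP => [/existsP[j Eji]|_]; last by apply: sumr_ge0 => j _; exact: f0.
rewrite (bigD1 j) /= ?Pi // lerDl; apply: sumr_ge0 => *; exact: f0.
Qed.

Section EdgeCounts.
Variable n : nat.
Implicit Types X Z : {set 'I_n}.

Definition pairs_between X Z : {set 'I_n * 'I_n} :=
  [set p : 'I_n * 'I_n | (p.1 < p.2)%N &&
     ((p.1 \in X) && (p.2 \in Z) || (p.2 \in X) && (p.1 \in Z))].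

(** The factor two is needed because [X] and [Z] may overlap, in which case an
    unordered pair can arise from two ordered ones; [#|Z|.-1] discounts the
    diagonal. *)
Lemma card_pairs_between X Z :
  (#|X| * #|Z|.-1 <= 2 * #|pairs_between X Z|)%N.
Proof.
pose Q := pairs_between X Z; pose swap (p : 'I_n * 'I_n) := (p.2, p.1).
pose D := [set (v, v) | v in X].
have swapI : injective swap by move=> [a a'] [d d'] [-> ->].
have sub : finset.setX X Z \subset D :|: Q :|: [set swap p | p in Q].
  apply/subsetP => -[x z]; rewrite !inE /= => /andP[xX zZ].
  have [xz|zx|/val_inj xz] := ltngtP x z.
  - by rewrite xX zZ orbT.
  - apply/orP; right; apply/imsetP; exists (z, x) => //.
    by rewrite inE /= zx xX zZ orbT.
  - by rewrite -xz; apply/orP; left; apply/orP; left; apply: imset_f.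
have cD : (#|D| <= #|X|)%N by exact: leq_imset_card.
have cS : #|[set swap p | p in Q]| = #|Q| by exact: card_imset.
have := subset_leq_card sub; rewrite cardsX.
have cU : (#|D :|: Q :|: [set swap p | p in Q]| <= #|D| + #|Q| + #|Q|)%N.
  rewrite -{2}cS; apply: leq_trans (leq_card_setU _ _).1 _.
  by rewrite leq_add2r (leq_card_setU _ _).1.
move=> cXZ; have {cU cXZ} := leq_trans cXZ cU; rewrite -/Q.
move: #|Q| #|D| cD => k d; case: #|Z| => [|m]; lia.
Qed.

End EdgeCounts.

Section Likelihood.
Variables (R : realType) (W : R * R -> R) (n : nat) (z : 'I_n -> R).
Hypothesis W01 : forall v w, 0 <= W (z v, z w) <= 1.

Definition simpleb (g : {set {set 'I_n}}) := [forall e in g, #|e| == 2%N].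

Lemma simpleP g : reflect (simple_graph g) (simpleb g).
Proof.
apply: (iffP forall_inP) => [s e eg|s e eg]; first exact/eqP/s.
exact/eqP/s.
Qed.

Lemma graph_likelihood_ge0 g : 0 <= graph_likelihood W z g.
Proof.
apply: prodr_ge0 => p _; have /andP[? ?] := W01 p.1 p.2.
by case: ifP; rewrite ?subr_ge0.
Qed.

(** Edges are drawn independently, so all the pairs of [Q] are non-edges with
    probability at most the product of the separate probabilities. Formally a
    simple graph is encoded by the set of its increasing pairs, and summing over
    all the sets of pairs expands a product of binary sums, each of which equals
    one outside [Q]. *)
Lemma sum_likelihood_avoiding (Q : {set 'I_n * 'I_n}) :
    (forall p, p \in Q -> (p.1 < p.2)%N) ->
  \sum_(g | simpleb g && [forall p in Q, [set p.1; p.2] \notin g])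
     graph_likelihood W z g <= \prod_(p in Q) (1 - W (z p.1, z p.2)).
Proof.
move=> ltQ; set P := (P in \sum_(g | P g) _).
pose w p := W (z p.1, z p.2).
pose h (p : 'I_n * 'I_n) := if (p.1 < p.2)%N && (p \notin Q) then w p else 0.
pose k (p : 'I_n * 'I_n) := if (p.1 < p.2)%N then 1 - w p else 1.
pose J (g : {set {set 'I_n}}) : {set 'I_n * 'I_n} :=
  [set p : 'I_n * 'I_n | (p.1 < p.2)%N && ([set p.1; p.2] \in g)].
have JK g : simpleb g -> [set [set p.1; p.2] | p : 'I_n * 'I_n in J g] = g.
  move=> /forall_inP sg; apply/setP => e; apply/imsetP/idP => [[p]|eg].
    by rewrite inE => /andP[_ ?] ->.
  have /cards2P[x [y [xy E]]] := sg e eg.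
  have [lt|lt|/val_inj E'] := ltngtP x y; last by rewrite E' eqxx in xy.
  - by exists (x, y) => //; rewrite inE /= lt -E.
  - by exists (y, x); rewrite /= 1?finset.setUC // inE /= lt finset.setUC -E.
have JI : {in [set g | P g] &, injective J}.
  move=> g g'; rewrite !inE => /andP[sg _] /andP[sg' _] E.
  by rewrite -(JK g sg) -(JK g' sg') E.
pose G (I : {set 'I_n * 'I_n}) : R := \prod_p (if p \in I then h p else k p).
have G0 I : 0 <= G I.
  apply: prodr_ge0 => p _; have /andP[? ?] := W01 p.1 p.2; rewrite /h /k /w.
  by do ![case: ifP => _] => //; rewrite subr_ge0.
have LG g : P g -> graph_likelihood W z g = G (J g).
  move=> /andP[_ /forall_inP avoid]; rewrite /graph_likelihood big_mkcond /=.
  apply: eq_bigr => p _; rewrite inE /h /k; case: ifP => //= lt.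
  case: ifP => //= pg; case: ifP => // /negbFE pQ.
  by have := avoid p pQ; rewrite pg.
have -> : \sum_(g | P g) graph_likelihood W z g =
    \sum_(I in J @: [set g | P g]) G I.
  by rewrite (big_imset _ JI) /= (eq_bigr _ LG); apply: eq_bigl => g; rewrite inE.
apply: (@le_trans _ _ (\sum_I G I)).
  by rewrite [leRHS](bigID (mem (J @: [set g | P g]))) /= lerDl sumr_ge0.
rewrite -bigA_distr [leRHS]big_mkcond /= le_eqVlt; apply/orP; left; apply/eqP.
apply: eq_bigr => p _; rewrite /h /k; have := ltQ p.
case: (p \in Q) => [/(_ isT) ->|_] /=; first by rewrite add0r.
by rewrite andbT; case: ifP => _; rewrite ?add0r // addrC subrK.
Qed.

End Likelihood.

Lemma sum_exp_card (R : comNzRingType) (T : finType) (u : R) :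
  \sum_(X : {set T}) u ^+ #|X| = (1 + u) ^+ #|T|.
Proof.
transitivity (\prod_(x : T) (u + 1)); last by rewrite prodr_const addrC.
rewrite bigA_distr; apply: eq_bigr => X _.
by rewrite -big_mkcond /= prodr_const.
Qed.

(** The union bound over the pairs [(X, Y)] needs no binomial estimate: as
    [#|X| + #|Y|] <= 2 [#|X|], a pair has probability at most
    [u ^+ #|X| * u ^+ #|Y|] with [u = r ^+ K], and the sum of this over all
    pairs is a power of [1 + u]. *)
Section SparseBound.
Variables (R : realType) (W : R * R -> R) (n q : nat) (z : 'I_n -> R).
Variables (b c : 'I_n -> 'I_q) (r : R) (K : nat).
Hypothesis W01 : forall v w, 0 <= W (z v, z w) <= 1.
Hypothesis r01 : 0 <= r <= 1.
Hypothesis symN : forall i j, #|arc_class b c i j| = #|arc_class b c j i|.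
Hypothesis bigN : forall v, (8 * K + 2 <= #|arc_class b c (b v) (c v)|)%N.
Hypothesis Wr : forall v w, b v = c w -> c v = b w -> 1 - W (z v, z w) <= r.

(** The subtracted term vanishes unless [X] and [Y] are both empty, which never
    happens for a sparse pair. *)
Lemma sum_likelihood_sparse_pair i j (X Y : {set 'I_n}) :
  \sum_(g | simpleb g && sparse_pair b c g i j X Y) graph_likelihood W z g <=
  (r ^+ K) ^+ #|X| * (r ^+ K) ^+ #|Y| - ((X == set0) && (Y == set0))%:R.
Proof.
have /andP[r0 r1] := r01; have u0 : 0 <= r ^+ K by exact: exprn_ge0.
have [/and4P[sX sY ltYX halfY]|nc] := boolP [&& X \subset arc_class b c i j,
    Y \subset arc_class b c j i, #|Y| < #|X| & 2 * #|Y| <= #|arc_class b c i j|]%N;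
  last first.
  rewrite big_pred0 => [|g]; last first.
    rewrite /sparse_pair; apply/negP => /andP[_ /and5P[? ? ? ? _]].
    by case/negP: nc; apply/and4P; split.
  case: (eqVneq X set0) => [->|_]; case: (eqVneq Y set0) => [->|_];
    rewrite ?cards0 ?expr0 ?mul1r ?mulr1 ?subrr ?subr0 //;
    by rewrite ?mulr_ge0 ?exprn_ge0.
have X0 : (X == set0) = false by rewrite -cards_eq0; lia.
rewrite X0 subr0.
pose Z := arc_class b c j i :\: Y; pose Q := pairs_between X Z.
apply: (@le_trans _ _ (\prod_(p in Q) (1 - W (z p.1, z p.2)))).
  apply: le_trans (sum_likelihood_avoiding W01 (Q := Q) _); last first.
    by move=> p; rewrite inE => /andP[].
  rewrite [leRHS](bigID (fun g => sparse_pair b c g i j X Y)) /=.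
  rewrite ler_wpDr ?sumr_ge0// => [g _|]; first exact: graph_likelihood_ge0.
  rewrite le_eqVlt; apply/orP; left; apply/eqP; apply: eq_bigl => g.
  rewrite -andbA; case: simpleb => //=; apply/idP/andP => [sp|[]//].
  split=> //; case/and5P: sp => _ _ _ _ /forall_inP avoid.
  apply/forall_inP => p; rewrite inE => /andP[_ /orP[] /andP[pX pZ]].
    exact: (forall_inP (avoid _ pX)).
  by rewrite finset.setUC; exact: (forall_inP (avoid _ pX)).
apply: (@le_trans _ _ (\prod_(p in Q) r)).
  apply: ler_prod => p; rewrite inE => /andP[_ pXZ].
  have /andP[? W1] := W01 p.1 p.2; rewrite subr_ge0 W1 /=.
  have inS i' j' v : v \in arc_class b c i' j' -> b v = i' /\ c v = j'.
    by rewrite inE => /andP[/eqP ? /eqP ?].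
  case/orP: pXZ => /andP[/(subsetP sX)/inS[bX cX]].
    by rewrite inE => /andP[_ /inS[bZ cZ]]; apply: Wr; congruence.
  by rewrite inE => /andP[_ /inS[bZ cZ]]; apply: Wr; congruence.
rewrite prodr_const -exprD -exprM; apply: ler_wiXn2l => //.
have /card_gt0P[v vX] : (0 < #|X|)%N by lia.
have := subsetP sX v vX; rewrite inE => /andP[/eqP bv /eqP cv].
have := bigN v; rewrite bv cv.
have := card_pairs_between X Z; have := cardsID Y (arc_class b c j i).
rewrite (setIidPr sY) -/Z -/Q -(symN i j).
move: #|Q| #|X| #|Y| #|Z| #|arc_class _ _ _ _| halfY ltYX => k x y m N.
move=> halfY ltYX cY kXZ bigS; have mK : (4 * K <= m.-1)%N by lia.
have : (x * (4 * K) <= 2 * k)%N by apply: leq_trans kXZ; rewrite leq_mul2l mK orbT.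
have : (K * (x + y) <= K * (x + x))%N by rewrite leq_mul2l; lia.
by move: mK; rewrite -/(4 * K)%N; lia.
Qed.

Lemma sum_likelihood_sparse :
  \sum_(g | simpleb g && [exists t : 'I_q * 'I_q * ({set 'I_n} * {set 'I_n}),
              sparse_pair b c g t.1.1 t.1.2 t.2.1 t.2.2])
    graph_likelihood W z g <= q%:R ^+ 2 * ((1 + r ^+ K) ^+ (n + n) - 1).
Proof.
set u := r ^+ K.
apply: le_trans (sum_union_bound _ _) _ => [g _|].
  exact: graph_likelihood_ge0.
pose B (s : {set 'I_n} * {set 'I_n}) : R :=
  u ^+ #|s.1| * u ^+ #|s.2| - ((s.1 == set0) && (s.2 == set0))%:R.
apply: (@le_trans _ _ (\sum_(t : 'I_q * 'I_q * ({set 'I_n} * {set 'I_n})) B t.2)).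
  by apply: ler_sum => -[[i j] [X Y]] _; exact: sum_likelihood_sparse_pair.
rewrite -(pair_bigA _ (fun (ij : 'I_q * 'I_q) s => B s)) /= sumr_const.
rewrite card_prod card_ord. rewrite -[leLHS]mulr_natl natrM -expr2 sumrB.
rewrite -(pair_bigA _ (fun X Y : {set 'I_n} => u ^+ #|X| * u ^+ #|Y|)) /=.
under eq_bigr => X _ do rewrite -mulr_sumr sum_exp_card.
rewrite -mulr_suml sum_exp_card card_ord -exprD.
rewrite (bigD1 (set0, set0)) //= !eqxx big1 ?addr0 // => -[X Y] /=.
by rewrite xpair_eqE => /negPf ->.
Qed.

End SparseBound.

(** * Failure probability given the blocks of the nodes *)

(** If the numbers [a i] are the amounts leaving the nodes of a path, and the
    edges carry the same amount in both directions, then starting from the node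
    without loop the load of each edge is forced: the edge [i.+1] carries what
    the edge [i] leaves over. This is the alternating sum of the [a i]. *)
Fixpoint path_weight (V : zmodType) (a : nat -> V) (j : nat) : V :=
  if j is i.+1 then a i - path_weight a i else 0.

(** Errors at most add up along the path, so integer loads, computed with
    truncated subtraction, remain close to the real ones; positivity of the
    latter ensures that the truncation never takes effect. *)
Lemma natural_path_weights (R : realDomainType) (q : nat) (cnt : nat -> nat)
    (x : nat -> R) (e : R) : 0 <= e ->
    (forall i, (i < q)%N -> `|(cnt i)%:R - x i| <= e) ->
    (forall j, (0 < j <= q)%N -> q%:R * e <= path_weight x j) ->
  exists F : nat -> nat,
    [/\ F 0 = 0%N, forall i, (i < q)%N -> (F i + F i.+1)%N = cnt i &
        forall j, (j <= q)%N -> path_weight x j - q%:R * e <= (F j)%:R].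
Proof.
move=> e0 near pos.
pose F := fix F j : nat := if j is i.+1 then (cnt i - F i)%N else 0%N.
have key j : (j <= q)%N -> `|(F j)%:R - path_weight x j| <= j%:R * e /\
    (forall i, j = i.+1 -> (F i <= cnt i)%N).
  elim: j => [_|j IH jq]; first by rewrite /= subrr normr0 mul0r; split.
  have {IH} [IH _] := IH (ltnW jq).
  have near_j := near j jq.
  have : (j.+1)%:R * e <= path_weight x j.+1.
    by apply: le_trans (pos j.+1 jq); rewrite ler_wpM2r // ler_nat.
  rewrite /= -natr1 mulrDl mul1r => pos_j.
  have le : (F j <= cnt j)%N.
    rewrite -(ler_nat R); move: IH near_j; rewrite !ler_norml.
    move=> /andP[? ?] /andP[? ?]; lra.
  split=> [|i [<-] //]; rewrite natrB // -/F.
  move: IH near_j; rewrite !ler_norml => /andP[? ?] /andP[? ?].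
  by apply/andP; split; lra.
exists F; split => // [i iq|j jq].
  by rewrite /= subnKC //; have [_] := key i.+1 iq; apply.
have [] := key j jq; rewrite ler_norml => /andP[low _] _.
have : j%:R * e <= q%:R * e by rewrite ler_wpM2r // ler_nat.
lra.
Qed.

Lemma path_adjC q : symmetric (@path_adj q).
Proof.
move=> i j; rewrite /path_adj orbCA eq_sym; congr (_ || (_ || _)).
by case: eqVneq => [->|].
Qed.

(** Half of the lower bound [2 * k] on the ideal loads absorbs the deviation of
    the block sizes from their means. *)
Lemma path_classes (R : realType) (n q : nat) (b : 'I_n -> 'I_q.+1)
    (x : nat -> R) (k : R) : 0 <= k ->
    (forall i : 'I_q.+1,
       `|#|[set v | b v == i]|%:R - n%:R * x i| <= k / q.+1%:R * n%:R) ->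
    (forall j, (0 < j <= q.+1)%N -> 2 * k <= path_weight x j) ->
  exists c : 'I_n -> 'I_q.+1,
    [/\ forall i j, #|arc_class b c i j| = #|arc_class b c j i|,
        forall v, path_adj (b v) (c v) &
        forall v, k * n%:R <= #|arc_class b c (b v) (c v)|%:R].
Proof.
move=> k0 near pos; have n0 : 0 <= n%:R :> R by [].
have wE j : path_weight (fun i => n%:R * x i) j = n%:R * path_weight x j.
  by elim: j => [|j IH] /=; rewrite ?mulr0 // IH mulrBr.
have eE : q.+1%:R * (k / q.+1%:R * n%:R) = k * n%:R.
  by rewrite mulrA mulrCA mulfV ?mulr1 // pnatr_eq0.
have [|i iq|j jq|F [F0 Fcnt Flow]] := @natural_path_weights R q.+1
    (fun i => #|[set v | b v == inord i]|) (fun i => n%:R * x i)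
    (k / q.+1%:R * n%:R).
- by rewrite mulr_ge0 // divr_ge0.
- by have := near (Ordinal iq); rewrite -[inord i]/(inord (Ordinal iq)) inord_val.
- rewrite wE eE mulrC; apply: ler_wpM2l => //; have := pos j jq; lra.
have [i|c cE] := @path_flow n q b F F0.
  by rewrite Fcnt // inord_val.
have adj v : path_adj (b v) (c v).
  (* The class of [v] contains [v]. *)
  apply: contraT => nadj; have := cE (b v) (c v); rewrite (negPf nadj).
  by move/eqP; rewrite cards_eq0 => /eqP/setP/(_ v); rewrite !inE !eqxx.
exists c; split => [i j|//|v].
  by rewrite !cE path_adjC /edge_index eq_sym maxnC.
rewrite cE adj; set j := edge_index _ _.
have jq : (0 < j <= q.+1)%N.
  move: (adj v); rewrite /j /edge_index /path_adj -!val_eqE /=.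
  by have := ltn_ord (b v); have := ltn_ord (c v); case: ifP; lia.
have /andP[_ jle] := jq; have := Flow j jle; rewrite wE eE.
have := ler_wpM2r n0 (pos j jq); lra.
Qed.

Theorem conditional_failure_bound (R : realType) (W : R * R -> R) (n q K : nat)
    (rep : 'I_q.+1 -> R) (b : 'I_n -> 'I_q.+1) (x : nat -> R) (k r : R) :
    0 <= k -> 0 <= r <= 1 -> (8 * K + 2)%:R <= k * n%:R ->
    (forall i j, 0 <= W (rep i, rep j) <= 1) ->
    (forall i j, path_adj i j -> 1 - W (rep i, rep j) <= r) ->
    (forall j, (0 < j <= q.+1)%N -> 2 * k <= path_weight x j) ->
    (forall i : 'I_q.+1,
       `|#|[set v | b v == i]|%:R - n%:R * x i| <= k / q.+1%:R * n%:R) ->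
  \sum_(g | simpleb g &&
            ~~ `[< has_hamiltonian_decomposition (directed_version g) >])
    graph_likelihood W (fun v => rep (b v)) g <=
  q.+1%:R ^+ 2 * ((1 + r ^+ K) ^+ (n + n) - 1).
Proof.
move=> k0 r01 Kn W01 Wr pos near.
have [c [symN adj big]] := path_classes k0 near pos.
have L0 g : 0 <= graph_likelihood W (fun v => rep (b v)) g.
  exact: graph_likelihood_ge0.
apply: le_trans (sum_likelihood_sparse (c := c) (K := K) _ r01 symN _ _).
- rewrite [leRHS](bigID (fun g =>
    ~~ `[< has_hamiltonian_decomposition (directed_version g) >])) /=.
  rewrite ler_wpDr ?sumr_ge0// le_eqVlt; apply/orP; left; apply/eqP.
  apply: eq_bigl => g; rewrite andbAC; have [sg|//] := simpleP g.
  have [|noH] := asboolP; first by rewrite andbF.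
  rewrite andbT; apply/esym/existsP; apply: contrapT => noSparse; apply: noH.
  have [i j X Y|f fI fg] := @injection_of_no_sparse_pair _ _ b c g symN.
    apply/negP => sp; apply: noSparse; by exists ((i, j), (X, Y)).
  exact: hamiltonian_decomposition_of_injection sg fI fg.
- by move=> v w; exact: W01.
- by move=> v; rewrite -(ler_nat R); apply: le_trans Kn (big v).
- by move=> v w bc cb; apply: Wr; rewrite -cb; exact: adj.
Qed.

(** * Concentration of the block sizes *)

Section ProductWeights.
Variables (R : realFieldType) (n : nat) (J : finType) (x : J -> R).
Hypotheses (x0 : forall i, 0 <= x i) (sum_x : \sum_i x i = 1).

Definition product_weight (b : {ffun 'I_n -> J}) := \prod_v x (b v).

Lemma product_weight_ge0 b : 0 <= product_weight b.
Proof. exact: prodr_ge0. Qed.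

Lemma sum_product_weight : \sum_b product_weight b = 1.
Proof.
by rewrite -(bigA_distr_bigA (fun=> x)) big1 // => i _; rewrite sum_x.
Qed.

(** Independence makes the mixed terms vanish: a centred factor can be averaged
    out on its own. *)
Lemma variance_product_weight (h : J -> R) : \sum_i x i * h i = 0 ->
  \sum_b product_weight b * (\sum_v h (b v)) ^+ 2 =
  n%:R * \sum_i x i * h i ^+ 2.
Proof.
move=> mean0.
transitivity (\sum_(v < n) \sum_(w < n) \sum_b product_weight b * (h (b v) * h (b w))).
  rewrite [RHS](eq_bigr (fun v => \sum_b \sum_w product_weight b * (h (b v) * h (b w)))).
    rewrite exchange_big /=; apply: eq_bigr => b _; rewrite expr2 mulr_suml mulr_sumr.
    by apply: eq_bigr => v _; rewrite mulr_sumr mulr_sumr.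
  by move=> v _; rewrite exchange_big.
pose f (v w u : 'I_n) (i : J) : R := x i * ((if u == v then h i else 1) * (if u == w then h i else 1)).
have fE v w : \sum_b product_weight b * (h (b v) * h (b w)) =
    \prod_(u < n) \sum_i f v w u i.
  rewrite bigA_distr_bigA; apply: eq_bigr => b _.
  by rewrite /f !big_split /= -!big_mkcond /= !big_pred1_eq.
under eq_bigr => v _ do under eq_bigr => w _ do rewrite fE.
have diag v : \prod_(u < n) \sum_i f v v u i = \sum_i x i * h i ^+ 2.
  rewrite (bigD1 v) //= [X in _ * X]big1 ?mulr1 => [|u uv].
    by apply: eq_bigr => i _; rewrite /f eqxx.
  by rewrite -[RHS]sum_x; apply: eq_bigr => i _; rewrite /f (negPf uv) !mulr1.
have offdiag v w : w != v -> \prod_(u < n) \sum_i f v w u i = 0.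
  move=> wv; rewrite (bigD1 v) //= -[X in X * _ = _]/(\sum_i f v w v i).
  rewrite [X in X * _](_ : _ = 0) ?mul0r // -[RHS]mean0.
  by apply: eq_bigr => i _; rewrite /f eqxx eq_sym (negPf wv) mulr1.
rewrite (eq_bigr (fun=> \sum_i x i * h i ^+ 2)) => [|v _].
  by rewrite sumr_const card_ord mulr_natl.
by rewrite (bigD1 v) //= diag [X in _ + X]big1 ?addr0 // => w; exact: offdiag.
Qed.

Lemma variance_count (k : J) :
  \sum_b product_weight b * (#|[set v | b v == k]|%:R - n%:R * x k) ^+ 2 <= n%:R.
Proof.
pose h i := (i == k)%:R - x k.
have hk : \sum_i x i * (i == k)%:R = x k.
  rewrite (bigD1 k) //= eqxx mulr1 [X in _ + X]big1 ?addr0 // => i /negPf ->.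
  by rewrite mulr0.
have xk1 : x k <= 1.
  by rewrite -sum_x (bigD1 k) //= lerDl sumr_ge0.
rewrite (eq_bigr (fun b => product_weight b * (\sum_v h (b v)) ^+ 2)) => [|b _].
  rewrite variance_product_weight /h; last first.
    under eq_bigr do rewrite mulrBr.
    by rewrite sumrB hk -mulr_suml sum_x mul1r subrr.
  rewrite -[leRHS]mulr1; apply: ler_wpM2l => //; rewrite -[leRHS]sum_x.
  apply: ler_sum => i _; rewrite -[leRHS]mulr1; apply: ler_wpM2l => //.
  have := x0 k; case: (i == k) => /= ?; nra.
congr (_ * _ ^+ 2); rewrite /h sumrB sumr_const card_ord mulr_natl.
congr (_ - _); rewrite -sum1_card big_mkcond natr_sum /=.
by apply: eq_bigr => v _; rewrite inE; case: eqP.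
Qed.

Lemma chebyshev_counts (e : R) : 0 < e ->
  \sum_(b : {ffun 'I_n -> J} |
       ~~ [forall k, `|#|[set v | b v == k]|%:R - n%:R * x k| <= e])
    product_weight b <= #|J|%:R * n%:R / e ^+ 2.
Proof.
move=> e0; have e2 : 0 < e ^+ 2 by rewrite exprn_gt0.
rewrite ler_pdivlMr // mulr_suml.
pose d (b : {ffun 'I_n -> J}) k : R := #|[set v : 'I_n | b v == k]|%:R - n%:R * x k.
apply: (@le_trans _ _ (\sum_b \sum_k product_weight b * d b k ^+ 2)).
  have term0 b k : 0 <= product_weight b * d b k ^+ 2.
    by rewrite mulr_ge0 ?product_weight_ge0 ?sqr_ge0.
  rewrite big_mkcond; apply: ler_sum => b _; case: ifPn => [|_]; last first.
    exact: sumr_ge0.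
  rewrite negb_forall => /existsP[k]; rewrite -ltNge => far.
  rewrite (bigD1 k) //=; apply: ler_wpDr; first exact: sumr_ge0.
  apply: ler_wpM2l; first exact: product_weight_ge0.
  rewrite -(real_normK (num_real (d b k))) ler_pXn2r ?nnegrE ?(ltW far) //.
  exact: ltW.
rewrite exchange_big /=.
rewrite mulr_natl -sumr_const; apply: ler_sum => k _; exact: variance_count.
Qed.

End ProductWeights.

From mathcomp Require Import all_fingroup.
From mathcomp Require Import all_classical all_reals all_analysis.

Import numFieldNormedType.Exports.
Local Open Scope classical_set_scope.
Local Open Scope ring_scope.

(** * The relative interior of the edge polytope *)

Lemma scalar_sum (R : pzRingType) (V : lmodType R) (phi : V -> R) (m : nat)
    (a : 'I_m -> R) (v : 'I_m -> V) :
  scalar phi -> phi (\sum_k a k *: v k) = \sum_k a k * phi (v k).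
Proof.
move=> lin; have phi0 : phi 0 = 0.
  by have := lin (-1) 0 0; rewrite scaler0 add0r mulN1r addNr.
elim/big_rec2: _ => [//|k y u _ <-]; exact: lin.
Qed.

(** If [phi] vanished at [x], then moving from [x] slightly away from [v] would
    stay in [A] and make [phi] negative. *)
Lemma relative_interior_gt0 (R : realType) (V : normedModType R) (A : set V)
    (phi : V -> R) (x v : V) :
    scalar phi -> (forall y, A y -> 0 <= phi y) -> A v -> 0 < phi v ->
  relative_interior A x -> 0 < phi x.
Proof.
move=> lin phi_ge0 Av phiv [Ax inner].
rewrite lt_neqAle phi_ge0 // andbT eq_sym; apply/eqP => phix.
have /nbhs_ballP[e /= e0 He] := inner.
pose t := e / (2 * (1 + `|x - v|)).
have d0 : 0 < 1 + `|x - v| by rewrite ltr_pwDl.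
have t0 : 0 < t by rewrite divr_gt0 // mulr_gt0.
pose y := t *: (x - v) + x.
have yE : y = (1 + t) *: x + (- t) *: v.
  by rewrite /y scalerBr scalerDl scale1r scaleNr addrC addrA.
suff Ay : A y.
  have := phi_ge0 y Ay; rewrite /y lin phix addr0 -[x - v]addrC -scaleN1r lin phix.
  by rewrite addr0 mulN1r mulrN oppr_ge0 leNgt mulr_gt0.
apply: He.
  rewrite -ball_normE /ball_ /= /y opprD addrCA subrr addr0 normrN normrZ.
  rewrite (gtr0_norm t0) /t mulrAC ltr_pdivrMr ?mulr_gt0 //.
  rewrite ltr_pM2l //; have := normr_ge0 (x - v); lra.
exists 2%N, (fun i => if i == ord0 then 1 + t else - t),
  (fun i => if i == ord0 then x else v); split.
- by rewrite big_ord_recl big_ord1 /= addrK.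
- by move=> i; case: ifP.
- by rewrite big_ord_recl big_ord1 /= yE.
Qed.

Lemma path_weight_scalar (R : pzRingType) (V : lmodType R) (coord : V -> nat -> R) l :
    (forall j, scalar (coord^~ j)) -> scalar (fun u => path_weight (coord u) l).
Proof.
move=> lin a u v; elim: l => [|l IH] /=; first by rewrite mulr0 addr0.
by rewrite lin IH mulrBr opprD addrACA.
Qed.

(** The enumeration is reversed when the loop is at the first node. *)
Lemma path_adj_enumeration (q : nat) (F : 'I_q.+1 -> 'I_q.+1 -> Prop) :
  path_with_end_loop F -> exists2 s : 'I_q.+1 -> 'I_q.+1,
    bijective s & forall i j, F (s i) (s j) <-> path_adj i j.
Proof.
case=> s [edges [k kend loops]].
have adjE (i j : 'I_q.+1) : i != j ->
    path_adj i j <-> i.+1 = j :> nat \/ j.+1 = i :> nat.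
  move=> ij; rewrite /path_adj (negPf ij) /= orbF.
  by split=> [/orP[] /eqP|[] /eqP ->]; [left|right| |rewrite orbT].
have loopE (i : 'I_q.+1) : path_adj i i <-> i.+1 = q.+1.
  by rewrite /path_adj eqxx /= !(gtn_eqF (ltnSn _)); split => /eqP.
have [k0|kq] : k = 0%N :> nat \/ k.+1 = q.+1 by case: kend; [left|right].
  exists (s \o @rev_ord q.+1).
    apply: bij_comp; first by exists s^-1%g => i; rewrite ?permK ?permKV.
    by exists (@rev_ord q.+1); exact: rev_ordK.
  move=> i j; have [<-|ij] := eqVneq i j => /=.
    rewrite loops loopE; have lti := ltn_ord i; split => [/(congr1 val) /= ?|?].
      lia.
    by apply: val_inj => /=; lia.
  rewrite edges ?(inj_eq rev_ord_inj) // adjE //=.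
  by have lti := ltn_ord i; have ltj := ltn_ord j; lia.
exists s; first by exists s^-1%g => i; rewrite ?permK ?permKV.
move=> i j; have [<-|ij] := eqVneq i j; last by rewrite edges // adjE.
rewrite loops loopE; split => [->//|iq].
by apply: val_inj => /=; lia.
Qed.

Section PathPolytope.
Variables (R : realType) (q : nat) (s : 'I_q.+1 -> 'I_q.+1).
Variable F : 'I_q.+1 -> 'I_q.+1 -> Prop.
Hypotheses (s_bij : bijective s) (Fs : forall i j, F (s i) (s j) <-> path_adj i j).

Definition path_coord (u : 'rV[R]_q.+1) (j : nat) := u 0 (s (inord j)).

Definition edge_vector (i j : 'I_q.+1) : 'rV[R]_q.+1 :=
  if i == j then 'e_i else 2^-1 *: ('e_i + 'e_j).

Lemma edge_vectorC i j : edge_vector i j = edge_vector j i.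
Proof. by rewrite /edge_vector eq_sym addrC; case: eqP => // ->. Qed.

Lemma path_coord_edge_vector (i j : 'I_q.+1) (m : nat) : (m <= q)%N ->
  path_coord (edge_vector (s i) (s j)) m =
  if i == j then (m == i)%:R else 2^-1 * ((m == i)%:R + (m == j)%:R).
Proof.
move=> mq; have sI := bij_inj s_bij; rewrite /path_coord /edge_vector (inj_eq sI).
have E (k : 'I_q.+1) : (s (inord m) == s k) = (m == k).
  by rewrite (inj_eq sI) -val_eqE /= inordK.
by case: ifP => _; rewrite !mxE /= ?E.
Qed.

(** The functionals [path_weight _ l] are, up to a factor, the barycentric
    coordinates of the edge polytope, which is a simplex: each of them singles
    out one edge and vanishes on all the others. *)
Lemma path_weight_edge_vector (i j : 'I_q.+1) l : path_adj i j -> (l <= q.+1)%N ->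
  path_weight (path_coord (edge_vector (s i) (s j))) l =
  (l == edge_index i j)%:R * (if i == j then 1 else 2^-1).
Proof.
wlog le_ij : i j / (i <= j)%N => [hwlog|].
  have [|/ltnW] := leqP i j; first exact: hwlog.
  by rewrite path_adjC edge_vectorC /edge_index (eq_sym i) maxnC; exact: hwlog.
move=> adj; elim: l => [_|l IH lq].
  rewrite /= /edge_index; case: ifPn => ij; rewrite ?mul0r //.
  have -> : (0%N == maxn i j) = false; last by rewrite mul0r.
  by move: adj ij; rewrite /path_adj -val_eqE /=; lia.
rewrite /= IH ?(ltnW lq) // path_coord_edge_vector //.
move: adj; rewrite /path_adj /edge_index; case: (eqVneq i j) => [<-|ij] /= adj.
  have iq : i = q :> nat by move: adj; lia.
  by rewrite iq eqSS (ltn_eqF lq) mul0r subr0 mulr1.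
have ji : j = i.+1 :> nat by move: adj; rewrite orbF; lia.
have -> : maxn i j = i.+1 by rewrite ji; lia.
by rewrite ji eqSS mulrC -mulrBl addrK.
Qed.

Lemma path_weight_gt0 (x : 'rV[R]_q.+1) l : (0 < l <= q.+1)%N ->
    relative_interior (edge_polytope F) x ->
  0 < path_weight (path_coord x) l.
Proof.
move=> /andP[l0 lq].
have lin : scalar (fun u => path_weight (path_coord u) l).
  by apply: path_weight_scalar => j a u v; rewrite /path_coord !mxE.
have [i [j [adj idx]]] : exists i j : 'I_q.+1, path_adj i j /\ edge_index i j = l.
  have [->|lq'] := eqVneq l q.+1.
    by exists ord_max, ord_max; rewrite /path_adj /edge_index !eqxx !orbT.
  exists (inord l.-1), (inord l); rewrite /path_adj /edge_index -val_eqE /=.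
  by rewrite !inordK; [case: ifP; lia|lia|lia].
apply: (relative_interior_gt0 (v := edge_vector (s i) (s j)) lin).
- move=> _ [m [a [v [a0 _ vP ->]]]]; rewrite (scalar_sum _ _ lin).
  apply: sumr_ge0 => k _; rewrite mulr_ge0 //.
  have [i' [j' [Fij ->]]] := vP k; have [s' sK s'K] := s_bij.
  rewrite -/(edge_vector i' j') -(s'K i') -(s'K j').
  rewrite path_weight_edge_vector //; last by apply/Fs; rewrite !s'K.
  by rewrite mulr_ge0 //; case: ifP => _; rewrite ?invr_ge0.
- exists 1%N, (fun=> 1), (fun=> edge_vector (s i) (s j)).
  split=> [//||_|]; rewrite ?big_ord1 ?scale1r //.
  by exists (s i), (s j); split=> //; apply/Fs.
- by rewrite path_weight_edge_vector // idx eqxx mul1r; case: ifP.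
Qed.

End PathPolytope.

(** * Passing from finite sums to the probability space *)

Lemma measure_bigcup_finType (R : realType) (d : measure_display)
    (T : measurableType d) (mu : {measure set T -> \bar R}) (I : finType)
    (Q : pred I) (F : I -> set T) :
    (forall i, Q i -> measurable (F i)) ->
    (forall i j w, Q i -> Q j -> F i w -> F j w -> i = j) ->
  mu (\bigcup_(i in [set i | Q i]) F i) = (\sum_(i | Q i) mu (F i))%E.
Proof.
move=> mF dF; rewrite measure_fin_bigcup //.
- have -> : [set i | Q i] = [set` enum Q].
    by apply/seteqP; split => i /=; rewrite mem_enum.
  by rewrite -fsbig_seq ?enum_uniq // big_enum.
- exact: finite_finset.
- by move=> i j Qi Qj [w [Fi Fj]]; exact: dF Fi Fj.
Qed.

Lemma uniform_prob_itvco (R : realType) (a b : R) : 0 <= a -> a < b -> b <= 1 ->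
  uniform_prob (@ltr01 R) `[a, b[ = (b - a)%:E.
Proof.
move=> a0 ab b1; rewrite /uniform_prob.
rewrite (eq_integral (cst 1%:E)) => [|x]; last first.
  rewrite inE /= in_itv /= /uniform_pdf => /andP[ax xb].
  by rewrite (le_trans a0 ax) (le_trans (ltW xb) b1) subr0 invr1.
by rewrite integral_cst //= lebesgue_measure_itv /= lte_fin ab mul1e.
Qed.

Section FiniteSample.
Variables (R : realType) (W : R * R -> R) (J : finType).
Variables (blk : J -> set R) (rep x : J -> R).
Hypotheses (blk_measurable : forall i, measurable (blk i))
  (blk_disjoint : forall i j t, blk i t -> blk j t -> i = j)
  (blk_prob : forall i, uniform_prob (@ltr01 R) (blk i) = (x i)%:E)
  (blk_rep : forall i j u v, blk i u -> blk j v -> W (u, v) = W (rep i, rep j)).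
Hypotheses (x0 : forall i, 0 <= x i) (sum_x : \sum_i x i = 1).
Variables (n : nat) (d : measure_display) (T : measurableType d).
Variables (P : probability T R) (y : 'I_n -> {RV P >-> R}).
Variable G : T -> {set {set 'I_n}}.
Hypothesis sample : sampled_from W n P y G.

(** The block of each node is prescribed by [b]. *)
Definition label_event (b : {ffun 'I_n -> J}) : set T :=
  \bigcap_v (y v @^-1` blk (b v)).

Lemma measurable_label_event b : measurable (label_event b).
Proof.
apply: fin_bigcap_measurable => // v _.
by rewrite -[X in measurable X]setTI; exact: measurable_funP.
Qed.

Lemma label_event_prob b : P (label_event b) = (product_weight x b)%:E.
Proof.
rewrite /label_event (sample_independent sample) //.
rewrite /product_weight -prodEFin; apply: eq_bigr => v _.
by rewrite -blk_prob -(sample_uniform sample v).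
Qed.

(** The conditional likelihood is constant on a label event because [W] only
    depends on the blocks, so the integral over this event is a product. *)
Lemma label_graph_prob b g : simple_graph g ->
  P (label_event b `&` G @^-1` [set g]) =
  (graph_likelihood W (fun v => rep (b v)) g * product_weight x b)%:E.
Proof.
move=> sg; pose B : set (n.-tuple R) := \bigcap_v ((@tnth n R)^~ v @^-1` blk (b v)).
have mB : measurable B.
  apply: fin_bigcap_measurable => // v _.
  by rewrite -[X in measurable X]setTI; exact: measurable_tnth.
have BE : [set w | B [tuple y i w | i < n]] = label_event b.
  apply/seteqP; split => w Bw v _; have := Bw v I; rewrite /= tnth_mktuple //.
have := sample_conditional sample mB sg; rewrite /= BE => ->.
rewrite (eq_integral (cst (graph_likelihood W (fun v => rep (b v)) g)%:E)).
  rewrite (integral_cst _ (measurable_label_event b)) EFinM.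
  by congr (_ * _)%E; exact: label_event_prob.
move=> w; rewrite inE => Aw; congr EFin; apply: eq_bigr => p _.
by rewrite (blk_rep (Aw p.1 I) (Aw p.2 I)).
Qed.

Lemma measurable_graph_event (Q : {set {set 'I_n}} -> Prop) :
  measurable [set w | Q (G w)].
Proof.
rewrite [X in measurable X](_ : _ = \bigcup_(g in [set g | Q g]) G @^-1` [set g]).
  by apply: fin_bigcup_measurable => // g _; exact: (sample_measurable sample).
apply/seteqP; split => [w Qw|w [g Qg /= ->] //].
by exists (G w).
Qed.

(** The label events are disjoint, and each good one loses at most the
    proportion [e2] of its probability to the failure of [H]. *)
Lemma sample_success_bound (H : {set {set 'I_n}} -> Prop)
    (good : pred {ffun 'I_n -> J}) (e1 e2 : R) : 0 <= e2 ->
    \sum_(b | ~~ good b) product_weight x b <= e1 ->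
    (forall b, good b -> \sum_(g | simpleb g && ~~ `[< H g >])
       graph_likelihood W (fun v => rep (b v)) g <= e2) ->
  ((1 - e1 - e2)%:E <= P [set w | H (G w)])%E.
Proof.
move=> e2_ge0 bad_labels bad_graphs; set S := [set w | H (G w)].
have mS : measurable S by exact: measurable_graph_event.
have mA b : measurable (label_event b) by exact: measurable_label_event.
have dA b b' w : label_event b w -> label_event b' w -> b = b'.
  by move=> Ab Ab'; apply/ffunP => v; exact: blk_disjoint (Ab v I) (Ab' v I).
have good_part b : good b ->
    ((product_weight x b * (1 - e2))%:E <= P (label_event b `&` S))%E.
  move=> gb.
  have fail : (P (label_event b `\` S) <= (product_weight x b * e2)%:E)%E.
    have -> : label_event b `\` S =
      \bigcup_(g in [set g | simpleb g && ~~ `[< H g >]])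
        (label_event b `&` G @^-1` [set g]).
      apply/seteqP; split => [w [Aw nS]|w [g /= /andP[_ /asboolPn nH] [Aw gE]]]; last first.
        by split=> //; rewrite /S /= gE.
      exists (G w) => //=; apply/andP; split; last exact/asboolPn.
      exact/simpleP/(sample_simple sample).
    rewrite measure_bigcup_finType //; last 2 first.
    - move=> g _; apply: measurableI => //; exact: (sample_measurable sample).
    - by move=> g g' w _ _ [_ <-] [_ <-].
    rewrite (eq_bigr (fun g => (graph_likelihood W (fun v => rep (b v)) g *
        product_weight x b)%:E)) => [|g /andP[/simpleP sg _]]; last first.
      exact: label_graph_prob.
    rewrite sumEFin lee_fin -mulr_suml mulrC ler_wpM2l ?product_weight_ge0 //.
    exact: bad_graphs.
  have E : (P (label_event b) =
      P (label_event b `\` S) + P (label_event b `&` S))%E.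
    exact: (measureDI P (mA b) mS).
  rewrite label_event_prob in E.
  have fin1 : P (label_event b `\` S) \is a fin_num.
    by rewrite fin_num_measure //; exact: measurableD.
  have fin2 : P (label_event b `&` S) \is a fin_num.
    by rewrite fin_num_measure //; exact: measurableI.
  move: E fail; rewrite -(fineK fin1) -(fineK fin2) -EFinD => -[->].
  by rewrite !lee_fin; lra.
have split_S : (\sum_(b | good b) P (label_event b `&` S) <= P S)%E.
  rewrite -measure_bigcup_finType; last 2 first.
  - by move=> b _; exact: measurableI.
  - by move=> b b' w _ _ [Ab _] [Ab' _]; exact: dA Ab Ab'.
  apply: le_measure; rewrite ?inE //.
    by apply: fin_bigcup_measurable => // b _; exact: measurableI.
  by move=> w [b _ []].
apply: le_trans split_S.
apply: (@le_trans _ _ (\sum_(b | good b) (product_weight x b * (1 - e2))%:E)%E);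
  last exact: lee_sum.
rewrite sumEFin lee_fin -mulr_suml.
have := sum_product_weight n sum_x; rewrite (bigID good) /=.
have : 0 <= \sum_(b : {ffun 'I_n -> J} | ~~ good b) product_weight x b.
  by apply: sumr_ge0 => b _; exact: product_weight_ge0.
move: bad_labels; set s1 := \sum_(b | ~~ _) _; set s2 := \sum_(b | _) _.
by move=> *; nra.
Qed.

End FiniteSample.

(** * Elementary bounds and limits *)

Lemma finite_lower_bound (R : realFieldType) (I : finType) (Q : pred I)
    (f : I -> R) : (forall i, Q i -> 0 < f i) ->
  exists2 k, 0 < k & forall i, Q i -> k <= f i.
Proof.
move=> f0; exists (\big[Num.min/1]_(i | Q i) f i); first exact: lt_bigmin.
by move=> i Qi; exact: bigmin_le_cond.
Qed.

(** With [t = (1 + r) / 2] one has [r <= t ^+ 2]; one factor [t ^+ k] is kept,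
    and [k.+1] times the other is at most the sum of the geometric series. *)
Lemma succn_expr_le (R : realFieldType) (r : R) k : 0 <= r < 1 ->
  k.+1%:R * r ^+ k <= ((1 + r) / 2) ^+ k / (1 - (1 + r) / 2).
Proof.
move=> /andP[r0 r1]; set t := (1 + r) / 2.
have t0 : 0 <= t by rewrite /t; lra.
have t1 : t < 1 by rewrite /t; lra.
have rt : r <= t * t by rewrite /t; nra.
have sum_t : k.+1%:R * t ^+ k <= (1 - t)^-1.
  rewrite -[leRHS]mul1r ler_pdivlMr ?subr_gt0 //.
  apply: (@le_trans _ _ ((\sum_(i < k.+1) t ^+ i) * (1 - t))).
    rewrite ler_wpM2r ?subr_ge0 ?(ltW t1) // mulr_natl -[k.+1 in leLHS]card_ord -sumr_const.
    by apply: ler_sum => i _; rewrite ler_wiXn2l ?(ltW t1) // -ltnS.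
  by rewrite mulrC -opprB mulNr -subrX1 opprB gerBl exprn_ge0.
apply: (@le_trans _ _ (k.+1%:R * (t ^+ k * t ^+ k))).
  by rewrite ler_wpM2l // -exprMn lerXn2r ?nnegrE //; apply: mulr_ge0.
by rewrite mulrA mulrC ler_wpM2l ?exprn_ge0.
Qed.

Lemma cvg_divn_infty M : (0 < M)%N -> (fun n => n %/ M)%N @ \oo --> \oo.
Proof.
move=> M0; apply/cvgnyPge => A; near=> n; rewrite leq_divRL //.
by near: n; exact: nbhs_infty_ge.
Unshelve. all: by end_near. Qed.

Lemma expr1D_le (R : realType) (r : R) (M n : nat) : 0 <= r < 1 -> (0 < M)%N ->
  (1 + r ^+ (n %/ M)) ^+ (n + n) <=
  expR (2 * M%:R / (1 - (1 + r) / 2) * ((1 + r) / 2) ^+ (n %/ M)).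
Proof.
move=> r01 M0; have /andP[r0 r1] := r01; set K := (n %/ M)%N.
have u0 : 0 <= r ^+ K by exact: exprn_ge0.
apply: (@le_trans _ _ (expR (r ^+ K) ^+ (n + n))).
  by rewrite lerXn2r ?nnegrE ?addr_ge0 ?expR_ge0 ?expR_ge1Dx.
rewrite -expRM_natl ler_expR.
have nK : (n + n)%:R <= 2 * M%:R * K.+1%:R :> R.
  rewrite -!natrM ler_nat; have := ltn_ceil n M0; rewrite -/K; lia.
apply: (@le_trans _ _ (2 * M%:R * (K.+1%:R * r ^+ K))).
  by rewrite mulrA ler_wpM2r.
have := ler_wpM2l (_ : 0 <= 2 * M%:R :> R) (succn_expr_le K r01).
rewrite mulr_ge0 // => /(_ isT) /le_trans; apply.
by rewrite mulrA mulrAC.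
Qed.

Lemma cvg_success_bound (R : realType) (C B A t : R) (M : nat) :
    0 <= t < 1 -> (0 < M)%N ->
  (1 - C * n.+1%:R^-1 - A * (expR (B * t ^+ (n %/ M)) - 1) : R)
    @[n --> \oo] --> (1 : R).
Proof.
move=> /andP[t0 t1] M0.
have E : 1 - C * 0 - A * (expR (B * 0) - 1) = 1 :> R.
  by rewrite !mulr0 expR0 subrr mulr0 !subr0.
have arg : B * t ^+ (n %/ M) @[n --> \oo] --> B * 0.
  apply: cvgMl_tmp.
  apply: (cvg_comp (fun n => (n %/ M)%N) (fun k => t ^+ k)).
    exact: cvg_divn_infty.
  by apply: cvg_expr; rewrite ger0_norm.
rewrite -[X in _ --> X]E; apply: cvgB.
  by apply: cvgB; [exact: cvg_cst|apply: cvgMl_tmp; exact: cvg_harmonic].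
apply: cvgMl_tmp; apply: cvgB; last exact: cvg_cst.
exact: (cvg_comp _ _ arg (@continuous_expR R _)).
Qed.

(** * Blocks of a step-graphon *)

Section Blocks.
Variables (R : realType) (W : R * R -> R) (q : nat) (sigma : 'I_q.+2 -> R).
Hypotheses (W_graphon : graphon W) (sigma_step : step_partition W sigma).
Implicit Types i j : 'I_q.+1.

Lemma lo_lt_hi i : lo sigma i < hi sigma i.
Proof. by apply: (step_increasing sigma_step) => /=; rewrite /bump. Qed.

Lemma sigma_le (a b : 'I_q.+2) : (a <= b)%N -> sigma a <= sigma b.
Proof.
rewrite leq_eqVlt => /orP[/eqP/val_inj -> //|ab].
exact/ltW/(step_increasing sigma_step).
Qed.

Lemma lo_ge0 i : 0 <= lo sigma i.
Proof. by rewrite -(step_first sigma_step) sigma_le. Qed.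

Lemma hi_le1 i : hi sigma i <= 1.
Proof. by rewrite -(step_last sigma_step) sigma_le // leq_ord. Qed.

Lemma block_lo i : block sigma i (lo sigma i).
Proof. by rewrite /block /= in_itv /= lexx lo_lt_hi. Qed.

Lemma block_disjoint i j t : block sigma i t -> block sigma j t -> i = j.
Proof.
rewrite /block /= !in_itv /= => /andP[it ti] /andP[jt tj].
have [ij|ji|/val_inj //] := ltngtP (i : nat) j.
- have : hi sigma i <= lo sigma j by apply: sigma_le.
  by move=> /(lt_le_trans ti)/(le_lt_trans jt); rewrite ltxx.
- have : hi sigma j <= lo sigma i by apply: sigma_le.
  by move=> /(lt_le_trans tj)/(le_lt_trans it); rewrite ltxx.
Qed.

Lemma W_lo01 i j : 0 <= W (lo sigma i, lo sigma j) <= 1.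
Proof.
have lo01 k : lo sigma k \in `[0, 1].
  rewrite in_itv /= lo_ge0 /=.
  exact: le_trans (ltW (lo_lt_hi k)) (hi_le1 k).
exact: (graphon_range W_graphon).
Qed.

Lemma W_blocks i j u v : block sigma i u -> block sigma j v ->
  W (u, v) = W (lo sigma i, lo sigma j).
Proof.
move=> iu jv; have [c Wc] := step_constant sigma_step i j.
by rewrite !Wc //; exact: block_lo.
Qed.

Lemma skeleton_gt0 i j : skeleton W sigma i j -> 0 < W (lo sigma i, lo sigma j).
Proof.
move=> Fij; have /andP[W0 _] := W_lo01 i j; rewrite lt_neqAle W0 andbT eq_sym.
by apply: Fij; exact: block_lo.
Qed.

Lemma sum_block_lengths : \sum_i (hi sigma i - lo sigma i) = 1.
Proof.
pose f m := sigma (inord m).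
rewrite (eq_bigr (fun i : 'I_q.+1 => f i.+1 - f i)) => [|i _].
  rewrite -(big_mkord xpredT (fun m => f m.+1 - f m)) telescope_sumr // /f.
  have -> : inord q.+1 = ord_max :> 'I_q.+2 by apply: val_inj; rewrite /= inordK.
  have -> : inord 0 = ord0 :> 'I_q.+2 by apply: val_inj; rewrite /= inordK.
  by rewrite (step_first sigma_step) (step_last sigma_step) subr0.
rewrite /f /hi /lo; congr (sigma _ - sigma _); apply: val_inj.
  by rewrite /= inordK // ltnS ltn_ord.
by rewrite /= inordK // ltnW // ltnS ltn_ord.
Qed.

End Blocks.

(** * Line graphons *)

Theorem proposition1 (R : realType) (W : R * R -> R) (q : nat)
    (sigma : 'I_q.+1 -> R)
    (hW : line_graphon W sigma)
    (hx : relative_interior (edge_polytope (skeleton W sigma))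
            (concentration sigma)) :
  H_property W.
Proof.
have [W_graphon sigma_step W_line] := hW.
case: q => [|q] in sigma hW hx sigma_step W_line *.
  by case: W_line => s [_ [[]]].
have [s s_bij Fs] := path_adj_enumeration W_line.
pose blk i := block sigma (s i); pose rep i := lo sigma (s i).
pose x i := hi sigma (s i) - lo sigma (s i).
have xE (i : 'I_q.+1) : x i = path_coord s (concentration sigma) i.
  by rewrite /path_coord inord_val !mxE.
have x0 i : 0 <= x i by rewrite subr_ge0 (ltW (lo_lt_hi sigma_step (s i))).
have sum_x : \sum_i x i = 1.
  rewrite -(sum_block_lengths sigma_step) [RHS](reindex s) //.
  exact: onW_bij.
(* The relative interior is used here only: all the ideal loads are positive. *)
have [k k0 weight_k] : exists2 k : R, 0 < k & forall j, (0 < j <= q.+1)%N ->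
    2 * k <= path_weight (path_coord s (concentration sigma)) j.
  have [//|k2 k20 kP] := @finite_lower_bound R 'I_q.+2 (fun j => 0 < j)%N
    (fun j => path_weight (path_coord s (concentration sigma)) j).
    move=> j j0; apply: (path_weight_gt0 s_bij Fs _ hx).
    by rewrite j0 -ltnS ltn_ord.
  exists (k2 / 2) => [|j /andP[j0 jq]]; first by rewrite divr_gt0.
  by rewrite mulrC divfK //; exact: (kP (Ordinal (jq : j < q.+2)%N)).
have [r r01 Wr] : exists2 r : R, 0 <= r < 1 & forall i j, path_adj i j ->
    1 - W (rep i, rep j) <= r.
  have [[i j] adj|p p0 pP] := @finite_lower_bound R _
    (fun e : 'I_q.+1 * 'I_q.+1 => path_adj e.1 e.2)
    (fun e => W (rep e.1, rep e.2)).
    by apply: (skeleton_gt0 W_graphon sigma_step); apply/Fs.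
  exists (1 - Num.min 1 p) => [|i j adj].
    by rewrite subr_ge0 ge_min lexx /= ltrBlDr ltrDl lt_min ltr01.
  by rewrite lerD2l lerN2 ge_min (pP (i, j)) ?orbT.
have /andP[r0 r1] := r01.
have [D D0 kD] : exists2 D, (0 < D)%N & D%:R^-1 <= k.
  exists (Num.truncn k^-1).+1 => //.
  rewrite -[leRHS]invrK lef_pV2 ?posrE ?invr_gt0 //.
  by rewrite ltW // truncnS_gt.
move=> d T P y G sample.
(* With [K = n %/ (16 * D)], [8 * K] is at most half of [n / D], and [2] at most
   the other half once [4 * D <= n]. *)
pose M := (16 * D)%N; have M0 : (0 < M)%N by rewrite muln_gt0.
pose t := (1 + r) / 2.
(* The factor [2] compensates for the replacement of [n] by [n.+1]. *)
pose C := 2 * (q.+1%:R / (k / q.+1%:R) ^+ 2).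
pose B := 2 * M%:R / (1 - t).
pose bound n : R := 1 - C * n.+1%:R^-1 - q.+1%:R ^+ 2 * (expR (B * t ^+ (n %/ M)) - 1).
have prob_le1 n : (P n [set w | has_hamiltonian_decomposition
    (directed_version (G n w))] <= 1)%E.
  apply: probability_le1.
  exact: (measurable_graph_event (sample n)
            (fun g => has_hamiltonian_decomposition (directed_version g))).
apply: (@squeeze_cvge _ _ _ _ (fun n => (bound n)%:E) _ (fun=> 1%E));
  [|apply: cvg_EFin; first by near=> n|exact: cvg_cst]; last first.
  by apply: cvg_success_bound => //; rewrite /t; lra.
near=> n; rewrite prob_le1 andbT.
have nD : (4 * D <= n)%N by near: n; exact: nbhs_infty_ge.
have n0 : (0 < n)%N by lia.
have nR0 : 0 < n%:R :> R by rewrite ltr0n.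
pose e := k / q.+1%:R * n%:R.
have kq0 : 0 < k / q.+1%:R by rewrite divr_gt0.
have e0 : 0 < e by rewrite mulr_gt0.
pose good (b : {ffun 'I_n -> 'I_q.+1}) :=
  [forall i, `|#|[set v | b v == i]%SET|%:R - n%:R * x i| <= e].
pose e2 : R := q.+1%:R ^+ 2 * ((1 + r ^+ (n %/ M)) ^+ (n + n) - 1).
have bad_labels : \sum_(b | ~~ good b) product_weight x b <= C * n.+1%:R^-1.
  have := chebyshev_counts n x0 sum_x e0 => /le_trans; apply; rewrite card_ord.
  rewrite /C /e exprMn.
  have -> : q.+1%:R * n%:R / ((k / q.+1%:R) ^+ 2 * n%:R ^+ 2) =
      q.+1%:R / (k / q.+1%:R) ^+ 2 * n%:R^-1 :> R.
    by field; rewrite ?pnatr_eq0 ?gt_eqF.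
  have inv_n : n%:R^-1 <= 2 * n.+1%:R^-1 :> R.
    rewrite ler_pdivlMr ?ltr0n // mulrC ler_pdivrMr // -natrM ler_nat; lia.
  rewrite [2 * _]mulrC -[leRHS]mulrA; apply: ler_wpM2l inv_n.
  by rewrite divr_ge0 // exprn_ge0 // ltW.
have Kn : (8 * (n %/ M) + 2)%:R <= k * n%:R.
  apply: (@le_trans _ _ (D%:R^-1 * n%:R)); last by rewrite ler_wpM2r.
  rewrite mulrC ler_pdivlMr ?ltr0n // -natrM ler_nat.
  have := leq_trunc_div n M; rewrite /M; nia.
have e2_ge0 : 0 <= e2.
  by rewrite mulr_ge0 ?exprn_ge0 // subr_ge0 exprn_ege1 // lerDl exprn_ge0.
have bad_graphs (b : {ffun 'I_n -> 'I_q.+1}) : good b ->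
    \sum_(g | simpleb g &&
              ~~ `[< has_hamiltonian_decomposition (directed_version g) >])
      graph_likelihood W (fun v => rep (b v)) g <= e2.
  move=> /forallP near_b.
  apply: (@conditional_failure_bound R W n q (n %/ M) rep b
            (path_coord s (concentration sigma)) k r) => //.
  - exact: ltW.
  - by rewrite r0 ltW.
  - by move=> i j; exact: (W_lo01 W_graphon sigma_step).
  - by move=> i; rewrite -xE; exact: near_b.
apply: le_trans (sample_success_bound (blk := blk) _ _ _ _ x0 sum_x (sample n) e2_ge0
                   bad_labels bad_graphs).
- rewrite lee_fin /bound lerD2l lerN2 ler_wpM2l ?exprn_ge0 // lerD2r.
  exact: expr1D_le.
- by move=> i; exact: measurable_itv.
- move=> i j u iu ju; apply: (bij_inj s_bij).
  exact: (block_disjoint sigma_step iu ju).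
- move=> i; apply: uniform_prob_itvco.
  + exact: (lo_ge0 sigma_step).
  + exact: (lo_lt_hi sigma_step).
  + exact: (hi_le1 sigma_step).
- by move=> i j u v; exact: (W_blocks sigma_step).
Unshelve. all: by end_near. Qed.
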